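(* There is a constant $k$ such that every (claw, $4K_1$, bridge, $C_4$-twin)-free graph $G$ that contains a $C_5$ (as an induced subgraph) has clique-width at most $k$.
   Context: All graphs are finite, simple and undirected. For a set $L$ of graphs, a graph $G$ is $L$-free if $G$ contains no graph of $L$ as an induced subgraph. $C_5$ is the chordless cycle on five vertices. The claw is $K_{1,3}$. $4K_1$ is the stable set on four vertices. The bridge is the six-vertex graph obtained from two disjoint copies of $K_4$ by identifying an edge of one with an edge of the other: its vertices are $u,v,a,b,c,d$, the sets $\{u,v,a,b\}$ and $\{u,v,c,d\}$ are cliques, and there are no edges between $\{a,b\}$ and $\{c,d\}$. The $C_4$-twin is the five-vertex graph on $\{1,2,3,4,5\}$ with edges $12,13,42,43,25,35,14$ (a chordless 4-cycle with one vertex duplicated by an adjacent twin). The clique-width of a graph is the smallest number of labels needed to construct it using the operations: create a new vertex with label $i$; take the disjoint union of two labelled graphs; relabel all vertices with label $i$ by label $j$; join every vertex labelled $i$ to every vertex labelled $j$ by an edge ($i\neq j$). *)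

(* Defs.v *)
From Stdlib Require List.
From HB Require Import structures.
From mathcomp Require Import all_boot boolp.

Set Implicit Arguments.
Unset Strict Implicit.
Unset Printing Implicit Defensive.

Record sgraph := SGraph {
  vertex :> finType;
  adj : rel vertex;
  adj_sym : symmetric adj;
  adj_irr : irreflexive adj }.

Definition isomorphic (T U : finType) (e : rel T) (e' : rel U) : Prop :=
  exists2 f : T -> U, bijective f & forall x y, e' (f x) (f y) = e x y.

Definition contains_induced (G H : sgraph) : Prop :=
  exists2 f : H -> G, injective f & forall x y, adj (f x) (f y) = adj x y.

Definition free (L : seq sgraph) (G : sgraph) : Prop :=
  forall H, List.In H L -> ~ contains_induced G H.

Section GraphOfEdges.
Variables (n : nat) (s : seq (nat * nat)).

Definition edges_adj : rel 'I_n := fun x y =>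
  (x != y) && (((val x, val y) \in s) || ((val y, val x) \in s)).

Lemma edges_adj_sym : symmetric edges_adj.
Proof. by move=> x y; rewrite /edges_adj eq_sym orbC. Qed.

Lemma edges_adj_irr : irreflexive edges_adj.
Proof. by move=> x; rewrite /edges_adj eqxx. Qed.

Definition graph_of_edges := SGraph edges_adj_sym edges_adj_irr.
End GraphOfEdges.

Definition C5 := graph_of_edges 5 [:: (0, 1); (1, 2); (2, 3); (3, 4); (4, 0)].

Definition claw := graph_of_edges 4 [:: (0, 1); (0, 2); (0, 3)].

Definition fourK1 := graph_of_edges 4 [::].

(* u, v, a, b, c, d are numbered 0, ..., 5. *)
Definition bridge := graph_of_edges 6
  [:: (0, 1); (0, 2); (0, 3); (1, 2); (1, 3); (2, 3);
      (0, 4); (0, 5); (1, 4); (1, 5); (4, 5)].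

(* The chordless 4-cycle 0, 1, 4, 2, with 3 an adjacent twin of 0. *)
Definition C4twin := graph_of_edges 5
  [:: (0, 1); (0, 2); (3, 1); (3, 2); (1, 4); (2, 4); (0, 3)].

Inductive cwexpr (k : nat) : Type :=
| CwVertex of 'I_k
| CwUnion of cwexpr k & cwexpr k
| CwRelabel of 'I_k & 'I_k & cwexpr k
| CwJoin (i j : 'I_k) of i != j & cwexpr k.

Section CwEval.
Variable k : nat.

Fixpoint cw_vertex (t : cwexpr k) : finType :=
  match t with
  | CwVertex _ => unit
  | CwUnion t1 t2 => (cw_vertex t1 + cw_vertex t2)%type
  | CwRelabel _ _ t1 => cw_vertex t1
  | CwJoin _ _ _ t1 => cw_vertex t1
  end.

Fixpoint cw_label (t : cwexpr k) : cw_vertex t -> 'I_k :=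
  match t return cw_vertex t -> 'I_k with
  | CwVertex i => fun _ => i
  | CwUnion t1 t2 => fun x =>
      match x with inl x1 => @cw_label t1 x1 | inr x2 => @cw_label t2 x2 end
  | CwRelabel i j t1 => fun x =>
      if @cw_label t1 x == i then j else @cw_label t1 x
  | CwJoin _ _ _ t1 => fun x => @cw_label t1 x
  end.

Fixpoint cw_adj (t : cwexpr k) : rel (cw_vertex t) :=
  match t return rel (cw_vertex t) with
  | CwVertex _ => fun _ _ => false
  | CwUnion t1 t2 => fun x y =>
      match x, y with
      | inl x1, inl y1 => @cw_adj t1 x1 y1
      | inr x2, inr y2 => @cw_adj t2 x2 y2
      | _, _ => false
      end
  | CwRelabel _ _ t1 => fun x y => @cw_adj t1 x y
  | CwJoin i j _ t1 => fun x y =>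
      [|| @cw_adj t1 x y,
          (@cw_label t1 x == i) && (@cw_label t1 y == j)
        | (@cw_label t1 x == j) && (@cw_label t1 y == i)]
  end.
End CwEval.
Arguments cw_label {k} t x.
Arguments cw_adj {k} t x y.

Definition cw_constructible (G : sgraph) (k : nat) : Prop :=
  exists t : cwexpr k, isomorphic (@adj G) (cw_adj t).

Section CwTrivialBound.
Variable G : sgraph.
Let k := #|G|.

Let discrete (s : seq G) : s != [::] -> uniq s ->
  exists (t : cwexpr k) (g : cw_vertex t -> G),
    [/\ injective g, forall x, x \in s <-> exists y, g y = x,
        forall x, cw_label t x = enum_rank (g x) & forall x y, cw_adj t x y = false].
Proof.
elim: s => [//|a [|b s] IHs] _.
  move=> _; exists (CwVertex (enum_rank a)), (fun=> a); split => //.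
    by move=> [] [].
  move=> x; rewrite inE; split => [/eqP->|[_ ->]] //.
rewrite cons_uniq => /andP[a_s us].
have [//|t [g [injg img lab adj0]]] := IHs _ us.
exists (CwUnion (CwVertex (enum_rank a)) t).
exists (fun x => match x with inl _ => a | inr y => g y end); split.
- move=> [[]|x] [[]|y] //= E.
  + by case/negP: a_s; apply/img; exists y.
  + by case/negP: a_s; apply/img; exists x.
  + by rewrite (injg _ _ E).
- move=> x; rewrite inE; split.
    case/orP=> [/eqP->|/img[y <-]]; first by exists (inl tt).
    by exists (inr y).
  move=> [[[] <-|y <-]]; first by rewrite eqxx.
  by apply/orP; right; apply/img; exists y.
- by move=> [[]|x] //=.
- by move=> [[]|x] [[]|y] /=.
Qed.

Lemma cw_constructible_card : 0 < #|G| -> cw_constructible G #|G|.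
Proof.
move=> G_gt0.
have [||t0 [g0 [injg0 img0 lab0 adj0]]] := @discrete (enum G).
- by rewrite -size_eq0 -cardE -lt0n.
- exact: enum_uniq.
have build (l : seq (G * G)) : all (fun p => adj p.1 p.2) l ->
  exists (t : cwexpr k) (g : cw_vertex t -> G),
    [/\ injective g, forall x, exists y, g y = x,
        forall x, cw_label t x = enum_rank (g x) &
        forall x y, cw_adj t x y = ((g x, g y) \in l) || ((g y, g x) \in l)].
  elim: l => [_|[a b] l IHl /= /andP[ab /IHl[t [g [injg surg lab adjt]]]]].
    exists t0, g0; split => // x.
    by apply/img0; rewrite mem_enum.
  have ab' : enum_rank a != enum_rank b.
    by apply: contraTneq ab => /enum_rank_inj ->; rewrite adj_irr.
  exists (CwJoin ab' t), g; split => // x y /=.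
  rewrite adjt !inE !lab !(inj_eq enum_rank_inj) !xpair_eqE.
  case: ((g x, g y) \in l); case: ((g y, g x) \in l); rewrite ?orbT //=.
  by rewrite !orbF (andbC (g x == b)).
have [|t [g [injg surg _ adjt]]] := build [seq p <- enum {: G * G} | adj p.1 p.2].
  by apply/allP => p; rewrite mem_filter => /andP[].
have bijg : bijective g.
  apply: inj_card_bij => //; rewrite -(card_codom injg); apply/subset_leq_card.
  by apply/subsetP => x _; have [y <-] := surg x; apply: codom_f.
have [f gK fK] := bijg.
exists t, f; first by exists g.
move=> x y; rewrite adjt !fK.
have inl p : (p \in [seq p <- enum {: G * G} | adj p.1 p.2]) = adj p.1 p.2.
  by rewrite mem_filter mem_enum andbT.
by rewrite !inl /= (adj_sym y x) orbb.
Qed.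

End CwTrivialBound.

Lemma cw_constructible_ex (G : sgraph) :
  0 < #|G| -> exists k, `[< cw_constructible G k >].
Proof. by move=> G_gt0; exists #|G|; apply/asboolP/cw_constructible_card. Qed.

(* The operations cannot produce a graph without vertices; its clique-width is
   set to 0. *)
Definition cliquewidth (G : sgraph) : nat :=
  match @idP (0 < #|G|) with
  | ReflectT G_gt0 => ex_minn (cw_constructible_ex G_gt0)
  | ReflectF _ => 0
  end.

Lemma cliquewidthP (G : sgraph) : 0 < #|G| ->
  cw_constructible G (cliquewidth G) /\
  forall k, cw_constructible G k -> cliquewidth G <= k.
Proof.
rewrite /cliquewidth; case: {-}_ / idP => // G_gt0 _.
by case: ex_minnP => n /asboolP Gn minn; split=> // k /asboolP/minn.
Qed.

(* Main.v *)
Require Import Defs.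
From mathcomp Require Import all_boot zify.

(** The induced C5 is used only to cover the graph by a bounded number of
    cliques.  Sort the vertices by their neighbourhood in the C5.  Two
    nonadjacent vertices with the same neighbourhood give a 4K1 if it is empty,
    and a claw if it is neither empty nor everything.  Among the vertices
    complete to the C5, claw and C4-twin leave at most one nonneighbour to each,
    so that two cliques suffice ([five_cycle_colourP]).

    From then on, let the graph be covered by N cliques, with no claw, bridge or
    C4-twin.  The bridge and the C4-twin force a vertex to have at most two
    neighbours or at most two nonneighbours in each clique, except for at most
    one vertex per pair of cliques ([card_mixed]).  Give each vertex a type: its
    clique, and the cliques to which it is almost complete.  Discard the
    vertices of types with few representatives.  Being almost complete is then
    an equivalence of types, transitive by the bridge ([linked_trans]): the graph
    looks like a disjoint union of a few large almost-cliques.  Call a pair of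
    vertices deviating if its adjacency is not the one that this picture
    predicts; every vertex is in at most 2N deviating pairs.

    The point is [dev_near].  If x-b and b-c deviate and x-c does not, then every
    deviating pair of the same kind as x-b comes close to {x, b, c}, because far
    away it would complete a claw or a C4-twin.  Thus, up to a bounded number of
    vertices, deviation is transitive, and the graph splits into classes of
    bounded size such that adjacency between different classes depends only on
    types.  Such a graph can be built class by class with a bounded number of
    labels ([blocks_cw_constructible]). *)

Set Implicit Arguments.
Unset Strict Implicit.
Unset Printing Implicit Defensive.

(** * Labelled constructions inside a fixed vertex set *)

Section Built.
Variables (T L : finType).
Implicit Types (A B : {set T}) (h : rel T) (l : T -> L).

(** The labelled graph with vertex set [A], adjacency [h] and labels [l] is the
    value of an expression.  The expressions have no empty value, hence the
    guard.  Keeping all vertex sets inside one ambient type avoids transport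
    along bijections of sum types. *)
Definition built A h l : Prop :=
  A != set0 -> exists (t : cwexpr #|L|) (g : cw_vertex t -> T),
    [/\ injective g, forall x, x \in A <-> exists y, g y = x,
        forall y, cw_label t y = enum_rank (l (g y)) &
        forall y z, cw_adj t y z = h (g y) (g z)].

Lemma built_ext A h h' l l' :
  {in A, l =1 l'} -> {in A &, h =2 h'} -> built A h l -> built A h' l'.
Proof.
move=> ll' hh' bA /bA[t [g [injg im lab hE]]].
have gA y : g y \in A by apply/im; exists y.
exists t, g; split=> // [y|y z]; first by rewrite lab ll'.
by rewrite hE hh'.
Qed.

Lemma built_relabel1 A h l i j :
  built A h l -> built A h (fun x => if l x == i then j else l x).
Proof.
move=> bA /bA[t [g [injg im lab hE]]].
exists (CwRelabel (enum_rank i) (enum_rank j) t), g; split=> //= y.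
by rewrite lab (inj_eq enum_rank_inj); case: ifP.
Qed.

Lemma built_join A h l i j : i != j -> built A h l ->
  built A (fun x y => [|| h x y, (l x == i) && (l y == j)
                        | (l x == j) && (l y == i)]) l.
Proof.
move=> neij bA /bA[t [g [injg im lab hE]]].
have neij' : enum_rank i != enum_rank j by rewrite (inj_eq enum_rank_inj).
exists (CwJoin neij' t), g; split=> //= y z.
by rewrite hE !lab !(inj_eq enum_rank_inj).
Qed.

Lemma built_isolated A h l z : z \notin A -> ~~ h z z ->
  {in A, forall x, h x z = false /\ h z x = false} ->
  built A h l -> built (z |: A) h l.
Proof.
move=> zA hzz hz bA _; have [A0|/bA[t [g [injg im lab hE]]]] := eqVneq A set0.
  exists (CwVertex (enum_rank (l z))), (fun=> z); split=> //=.
  - by move=> [] [].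
  - by move=> x; rewrite A0 setU0 inE; split=> [/eqP->|[_ ->]].
  - by move=> _ _; rewrite (negbTE hzz).
have gA y : g y \in A by apply/im; exists y.
exists (CwUnion (CwVertex (enum_rank (l z))) t).
exists (fun x => match x with inl _ => z | inr y => g y end); split=> /=.
- move=> [[]|x] [[]|y] //= E.
  + by move: zA; rewrite E gA.
  + by move: zA; rewrite -E gA.
  + by rewrite (injg _ _ E).
- move=> x; rewrite !inE; split.
    case/orP=> [/eqP->|/im[y <-]]; first by exists (inl tt).
    by exists (inr y).
  by move=> [[[] <-|y <-]]; rewrite ?eqxx // gA orbT.
- by move=> [[]|x] /=.
- move=> [[]|x] [[]|y] //=; first by rewrite (negbTE hzz).
    by case: (hz (g y) (gA y)) => _ ->.
  by case: (hz (g x) (gA x)) => -> _.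
Qed.

End Built.

Section BuiltMap.
Variables (T K : finType).
Implicit Types (A B : {set T}) (h : rel T).

(** Relabellings of an expression act one label at a time, so a map of labels
    such as a permutation needs scratch labels.  The second copy of [K] provides
    them: the labels move there with their new values, and then back. *)
Lemma built_map A h (l : T -> K) (f : K -> K) :
  built A h (fun x => (false, l x)) -> built A h (fun x => (false, f (l x))).
Proof.
move=> bA.
have away ks : uniq ks -> built A h
    (fun x => if l x \in ks then (true, f (l x)) else (false, l x)).
  elim: ks => [_|k ks IHk /= /andP[kks /IHk]]; first exact: built_ext bA.
  move/(built_relabel1 (false, k) (true, f k)); apply: built_ext => // x _.
  rewrite inE; case: (eqVneq (l x) k) => [->|lxk] /=.
    by rewrite (negbTE kks) eqxx.
  by case: (l x \in ks); rewrite xpair_eqE //= (negbTE lxk).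
have back (ks : seq K) : built A h (fun x => (f (l x) \notin ks, f (l x))).
  elim: ks => [|k ks IHk].
    by apply: built_ext (away _ (enum_uniq K)) => // x _; rewrite mem_enum.
  move/(built_relabel1 (true, k) (false, k)): IHk; apply: built_ext => // x _.
  rewrite inE xpair_eqE negb_or /=; case: (eqVneq (f (l x)) k) => [->|_].
    by case: (k \in ks).
  by rewrite andbF.
by apply: built_ext (back (enum K)) => // x _; rewrite mem_enum.
Qed.

End BuiltMap.

Section Grow.
Variables (T K : finType) (h : rel T).
Hypotheses (h_sym : symmetric h) (h_irr : irreflexive h).
Implicit Types (A B : {set T}) (l : T -> K).

(** One label, here [None], is reserved for a vertex that has just been added:
    it is joined to the old vertices while it carries a label of its own. *)
Definition kbuilt A l := built A h (fun x => (false, Some (l x))).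

Lemma kbuilt_map A l l' (f : K -> K) :
  {in A, forall x, l' x = f (l x)} -> kbuilt A l -> kbuilt A l'.
Proof.
move=> l'E bA; have := @built_map _ _ _ _ (Some \o l) (omap f) bA.
apply: built_ext => // x xA /=.
by rewrite l'E.
Qed.

Lemma kbuilt_add A l z : z \notin A ->
  {in A &, forall x y, l x = l y -> h x z = h y z} ->
  kbuilt A l -> kbuilt (z |: A) l.
Proof.
move=> zA lz bA.
pose l0 x := (false, if x == z then None else Some (l x)).
pose hh (ks : seq K) : rel T := fun x y =>
  if x == z then (y != z) && (l y \in ks) && h y z else
  if y == z then (l x \in ks) && h x z else h x y.
have neA x : x \in A -> (x == z) = false.
  by move=> xA; apply: contraNF zA => /eqP<-.
have joined ks : built (z |: A) (hh ks) l0.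
  elim: ks => [|k ks IHk].
    apply: built_isolated => //; first by rewrite /hh eqxx.
      by move=> x xA; rewrite /hh eqxx (neA x xA) /=.
    apply: built_ext bA => [x xA|x y xA yA]; first by rewrite /l0 (neA x xA).
    by rewrite /hh (neA x xA) (neA y yA).
  case: (boolP [exists x in A, (l x == k) && h x z]) => [|/exists_inPn nok].
    case/exists_inP => x0 x0A /andP[/eqP lx0 hx0].
    have := built_join (_ : (false, Some k) != (false, None)) IHk.
    move/(_ isT); apply: built_ext => // x y.
    rewrite /hh /l0 !inE !xpair_eqE /=.
    case: (eqVneq x z) => [_|xz] /=; case: (eqVneq y z) => [_|yz] //=;
      rewrite ?(andbF, andbT, orbF) //=.
      move=> _ yA; rewrite (inj_eq Some_inj).
      have [lyk|_] := eqVneq (l y) k; rewrite /= ?orbF //.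
      by rewrite [RHS](lz y x0) ?hx0 ?orbT // lyk.
    move=> xA _; rewrite (inj_eq Some_inj).
    have [lxk|_] := eqVneq (l x) k; rewrite /= ?orbF //.
    by rewrite [RHS](lz x x0) ?hx0 ?orbT // lxk.
  have nokA x : x \in A -> l x = k -> h x z = false.
    by move=> xA lxk; move: (nok x xA); rewrite lxk eqxx; apply: negbTE.
  apply: built_ext IHk => // x y; rewrite /hh !inE.
  case: (eqVneq x z) => [_|xz] /=; case: (eqVneq y z) => [_|yz] //=.
    move=> _ yA; case: (eqVneq (l y) k) => [/(nokA _ yA)->|] //=.
    by rewrite !andbF.
  move=> xA _; case: (eqVneq (l x) k) => [/(nokA _ xA)->|] //=.
  by rewrite !andbF.
have := @built_map _ _ _ _ (fun x => if x == z then None else Some (l x))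
  (fun o => if o is Some k then Some k else Some (l z)) (joined (enum K)).
apply: built_ext => [x xA|x y xA yA].
  by rewrite /l0; case: eqP => [->|].
by rewrite /hh !mem_enum /=; case: eqP => [->|_]; case: eqP => [->|_] //=.
Qed.

(** The hypothesis is what an insertion order needs: whenever a vertex of [B]
    arrives, the labels of the vertices present decide the new adjacencies. *)
Lemma kbuilt_grow A B l : [disjoint A & B] ->
  {in B, forall z, {in A :|: B &, forall x y, l x = l y -> h x z = h y z}} ->
  kbuilt A l -> kbuilt (A :|: B) l.
Proof.
move=> dAB lB bA.
have grow s : {subset s <= B} -> uniq s -> kbuilt (A :|: [set:: s]) l.
  elim: s => [_ _|z s IHs sB /= /andP[zs us]].
    by rewrite set_nil setU0.
  have zB : z \in B by apply: sB; rewrite mem_head.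
  have sB' : {subset s <= B} by move=> x xs; apply: sB; rewrite inE xs orbT.
  rewrite set_cons setUCA; apply: kbuilt_add (IHs sB' us).
    by rewrite !inE (negbTE zs) orbF (disjointFl dAB).
  have sub : {subset A :|: [set:: s] <= A :|: B}.
    by move=> x; rewrite !inE => /orP[->//|/sB'->]; rewrite orbT.
  by move=> x y xA yA; apply: (lB z zB); apply: sub.
have -> : B = [set:: enum B] by apply/setP=> x; rewrite inE mem_enum.
by apply: grow (enum_uniq _) => x; rewrite mem_enum.
Qed.

End Grow.

(** * Graphs made of small blocks *)

Section Blocks.
Variables (G : sgraph) (C : finType) (s b : nat).
Variables (S : {set G}) (col : G -> C) (M : rel C) (d : rel G).

Let K : finType := ('I_s.+1 + 'I_b.+1 + C)%type.

Hypothesis card_S : #|S| <= s.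
Hypothesis d_sym : {in ~: S &, symmetric d}.
Hypothesis d_trans :
  {in ~: S & &, forall y x z, d x y -> d y z -> x != z -> d x z}.
Hypothesis d_deg : {in ~: S, forall x, #|[set y in ~: S | d x y]| <= b}.
Hypothesis adj_col :
  {in ~: S &, forall x y, x != y -> ~~ d x y -> adj x y = M (col x) (col y)}.

Let block x := x |: [set y in ~: S | d x y].

(** [P] is the class being inserted.  A position in [enum] is a label of bounded
    range which is injective on a small set. *)
Let label (P : {set G}) x : K :=
  if x \in S then inl (inl (inord (index x (enum S))))
  else if x \in P then inl (inr (inord (index x (enum P))))
  else inr (col x).

Let inord_index_inj n (B : {set G}) : #|B| <= n.+1 ->
  {in B &, injective (fun x => inord (index x (enum B)) : 'I_n.+1)}.
Proof.
move=> Bn x y xB yB /(congr1 val) /=.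
have lt z : z \in B -> index z (enum B) < n.+1.
  by move=> zB; rewrite (leq_trans _ Bn) // cardE index_mem mem_enum.
rewrite !inordK ?lt // => E.
by rewrite -(nth_index x (_ : x \in enum B)) ?mem_enum // E nth_index ?mem_enum.
Qed.

(** Insert first the vertices of [S], and then the classes of [d] one after the
    other.  Vertices of [S] and of the current class have labels of their own;
    a finished class is relabelled by colours, as these decide all adjacencies
    to later vertices. *)
Lemma blocks_cw_constructible : 0 < #|G| ->
  cw_constructible G #|{: bool * option K}|.
Proof.
have built0 : kbuilt (@adj G) S (label set0).
  rewrite -[S]set0U; apply: kbuilt_grow; rewrite ?disjoints_subset ?sub0set //.
  - exact: adj_sym.
  - exact: adj_irr.
  - move=> z _ x y; rewrite !set0U => xS yS; rewrite /label xS yS => -[].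
    by move/(inord_index_inj (leqW card_S) xS yS)->.
  - by rewrite /kbuilt /built eqxx.
have step (A : {set G}) x : S \subset A ->
    {in A :\: S, forall y, block y \subset A} ->
    x \notin A -> kbuilt (@adj G) A (label set0) ->
    kbuilt (@adj G) (A :|: block x) (label set0).
  move=> SA clA xA bA.
  have xS : x \in ~: S by rewrite inE; apply: contra xA; apply: subsetP.
  have blockS y : y \in block x -> y \in ~: S.
    by case/setU1P=> [->//|]; rewrite inE => /andP[].
  have dis y z : y \in A -> y \in ~: S -> z \in block x -> ~~ d y z.
    move=> yA yS zB; apply: contra xA => dyz.
    have clAy : block y \subset A by apply: clA; rewrite inE yA andbT -in_setC.
    have zS := blockS _ zB.
    case/setU1P: zB => [E|]; last (rewrite inE => /andP[_ dxz]).
      by apply: (subsetP clAy); rewrite -E in_setU1 inE zS dyz orbT.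
    have [->//|yx] := eqVneq x y.
    have dyx : d y x.
      by apply: (d_trans zS yS xS dyz); rewrite 1?d_sym // eq_sym.
    by apply: (subsetP clAy); rewrite in_setU1 inE xS dyx orbT.
  have disA : [disjoint A & block x].
    apply/pred0P=> y /=; apply/negP => /andP[yA yB].
    have yS := blockS _ yB.
    case/setU1P: yB => [E|]; first by rewrite -E yA in xA.
    rewrite inE => /andP[_ dxy]; move: (dis y x yA yS).
    by rewrite d_sym // dxy setU11 => /(_ isT).
  have lA : {in A, label (block x) =1 label set0}.
    by move=> y yA; rewrite /label in_set0 (disjointFr disA yA).
  have card_block : #|block x| <= b.+1.
    by rewrite cardsU1 -addn1 addnC leq_add ?d_deg // leq_b1.
  have bB : kbuilt (@adj G) (A :|: block x) (label (block x)).
    apply: kbuilt_grow => //; [exact: adj_sym|exact: adj_irr| |]; last first.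
      by apply: (kbuilt_map (f := id) _ bA) => y /lA.
    move=> z zB y y' yAB yAB'; rewrite /label.
    have zS := blockS _ zB.
    have [yS|yS] := boolP (y \in S); have [yS'|yS'] := boolP (y' \in S).
    - by case=> /(inord_index_inj (leqW card_S) yS yS')->.
    - by case: ifP.
    - by case: ifP.
    have [yB|yB] := boolP (y \in block x);
      have [yB'|yB'] := boolP (y' \in block x) => //.
      by case=> /(inord_index_inj card_block yB yB')->.
    move: yAB; rewrite in_setU (negbTE yB) orbF => yA.
    move: yAB'; rewrite in_setU (negbTE yB') orbF => yA' [E].
    rewrite -!in_setC in yS yS'.
    have nez u : u \in A -> u != z.
      by apply: contraTneq => ->; rewrite (disjointFl disA).
    by rewrite !adj_col ?E ?dis ?nez.
  pose f (k : K) : K :=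
    if k is inl (inr i) then inr (col (nth x (enum (block x)) i)) else k.
  apply: (kbuilt_map (f := f) _ bB) => y yAB; rewrite /label in_set0.
  case: ifP => // _; case: ifP => //= yB.
  rewrite inordK ?nth_index ?mem_enum //.
  by rewrite (leq_trans _ card_block) // cardE index_mem mem_enum.
have all_built n (A : {set G}) : #|~: A| <= n -> S \subset A ->
    {in A :\: S, forall y, block y \subset A} ->
    kbuilt (@adj G) A (label set0) -> kbuilt (@adj G) setT (label set0).
  elim: n A => [|n IHn] A.
    by rewrite leqn0 cards_eq0 -setCT => /eqP/(can_inj setCK) <-.
  have [->//|] := eqVneq A setT.
  rewrite -subTset => /subsetPn[x _ xA] cA SA clA bA.
  have xS : x \in ~: S by rewrite inE; apply: contra xA; apply: subsetP.
  apply: IHn (step _ _ SA clA xA bA).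
  - rewrite -ltnS (leq_trans _ cA) //; apply: proper_card; apply/properP; split.
      by rewrite setCS subsetUl.
    by exists x; rewrite !inE ?xA ?eqxx ?orbT.
  - by rewrite (subset_trans SA) ?subsetUl.
  move=> y; rewrite inE in_setU => /andP[yS /orP[yA|yB]].
    by apply: subset_trans (subsetUl _ _); apply: clA; rewrite inE yS.
  rewrite -in_setC in yS.
  apply: subset_trans (subsetUr _ _); apply/subsetP => z.
  case/setU1P=> [->//|]; rewrite inE => /andP[zS dyz].
  case/setU1P: yB => [E|]; first by rewrite -E in_setU1 inE zS dyz orbT.
  rewrite inE => /andP[_ dxy]; rewrite in_setU1 inE zS /=.
  have [//|xz] := eqVneq z x.
  by rewrite (d_trans yS xS zS dxy dyz) // eq_sym.
move=> G_gt0.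
have := all_built #|~: S| S (leqnn _) (subxx _) _ built0.
case=> [y||t [g [injg im lab hE]]].
- by rewrite setDv inE.
- by rewrite -card_gt0 cardsT.
have bijg : bijective g.
  apply: inj_card_bij => //; rewrite -(card_codom injg); apply/subset_leq_card.
  by apply/subsetP => x _; have [y <-] := (im x).1 (in_setT x); apply: codom_f.
have [f gK fK] := bijg.
exists t, f; first by exists g.
by move=> x y; rewrite hE !fK.
Qed.

End Blocks.

(** * Forbidden induced subgraphs *)

Section Forbidden.
Variable G : sgraph.

Lemma adj_neq (x y : G) : adj x y -> x != y.
Proof. by apply: contraTneq => ->; rewrite adj_irr. Qed.

Lemma adj_neq_r (x y z : G) : adj x z -> ~~ adj y z -> x != y.
Proof. by move=> xz; apply: contraNneq => <-. Qed.

Lemma contains_induced_nth n (E : seq (nat * nat)) (x0 : G) (s : seq G) :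
  size s = n -> uniq s ->
  (forall i j : 'I_n, i < j ->
    adj (nth x0 s i) (nth x0 s j) =
      ((val i, val j) \in E) || ((val j, val i) \in E)) ->
  contains_induced G (graph_of_edges n E).
Proof.
move=> sn us adjE; exists (fun i : 'I_n => nth x0 s i) => [i j /eqP|i j].
  by rewrite nth_uniq ?sn ?ltn_ord // => /eqP/val_inj.
rewrite /= /edges_adj; case: (ltngtP i j) => [ij|ji|/val_inj->].
- by rewrite adjE // (_ : i != j) // -val_eqE neq_ltn ij.
- by rewrite adj_sym adjE // orbC (_ : i != j) // -val_eqE neq_ltn ji orbT.
- by rewrite adj_irr eqxx.
Qed.

Lemma claw_freeE : ~ contains_induced G claw -> forall x a b c : G,
  adj x a -> adj x b -> adj x c -> ~~ adj a b -> ~~ adj a c -> ~~ adj b c ->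
  a != b -> a != c -> b != c -> False.
Proof.
move=> free x a b c xa xb xc ab ac bc neab neac nebc; apply: free.
apply: (@contains_induced_nth _ _ x [:: x; a; b; c]) => //.
  by rewrite /= !inE !negb_or neab neac nebc !adj_neq.
by move=> [[|[|[|[|//]]]] ?] [[|[|[|[|//]]]] ?] //= _;
  rewrite ?xa ?xb ?xc ?(negbTE ab) ?(negbTE ac) ?(negbTE bc).
Qed.

Lemma fourK1_freeE : ~ contains_induced G fourK1 -> forall a b c d : G,
  ~~ adj a b -> ~~ adj a c -> ~~ adj a d -> ~~ adj b c -> ~~ adj b d ->
  ~~ adj c d -> uniq [:: a; b; c; d] -> False.
Proof.
move=> free a b c d ab ac ad bc bd cd un; apply: free.
apply: (@contains_induced_nth _ _ a [:: a; b; c; d]) => //.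
by move=> [[|[|[|[|//]]]] ?] [[|[|[|[|//]]]] ?] //= _; apply: negbTE.
Qed.

Lemma C4twin_freeE : ~ contains_induced G C4twin -> forall t t' p q r : G,
  adj t t' -> adj t p -> adj t q -> adj t' p -> adj t' q -> adj r p ->
  adj r q -> ~~ adj p q -> ~~ adj r t -> ~~ adj r t' -> p != q -> False.
Proof.
move=> free t t' p q r tt tp tq t'p t'q rp rq pq rt rt' nepq; apply: free.
have [pt' qt'] : adj p t' /\ adj q t' by split; rewrite adj_sym.
have [pr qr] : adj p r /\ adj q r by split; rewrite adj_sym.
have [tr t'r] : ~~ adj t r /\ ~~ adj t' r by split; rewrite adj_sym.
apply: (@contains_induced_nth _ _ t [:: t; p; q; t'; r]) => //.
  rewrite /= !inE !negb_or nepq (@adj_neq_r t r t') //.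
  by rewrite (@adj_neq_r t' r t) ?(adj_sym t') // !adj_neq.
by move=> [[|[|[|[|[|//]]]]] ?] [[|[|[|[|[|//]]]]] ?] //= _; apply: negbTE.
Qed.

Lemma bridge_freeE : ~ contains_induced G bridge -> forall u v a b c d : G,
  adj u v -> adj u a -> adj u b -> adj v a -> adj v b -> adj a b ->
  adj u c -> adj u d -> adj v c -> adj v d -> adj c d ->
  ~~ adj a c -> ~~ adj a d -> ~~ adj b c -> ~~ adj b d -> False.
Proof.
move=> free u v a b c d uv ua ub va vb ab uc ud vc vd cd ac ad bc bd.
apply: free; have [ba dc] : adj b a /\ adj d c by split; rewrite adj_sym.
have [ca cb] : ~~ adj c a /\ ~~ adj c b by split; rewrite adj_sym.
have [da db] : ~~ adj d a /\ ~~ adj d b by split; rewrite adj_sym.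
apply: (@contains_induced_nth _ _ u [:: u; v; a; b; c; d]) => //.
  rewrite /= !inE !negb_or.
  rewrite (@adj_neq_r a c b) // (@adj_neq_r a d b) //.
  by rewrite (@adj_neq_r b c a) // (@adj_neq_r b d a) // !adj_neq.
by move=> [[|[|[|[|[|[|//]]]]]] ?] [[|[|[|[|[|[|//]]]]]] ?] //= _; apply: negbTE.
Qed.

End Forbidden.

(** * Graphs covered by few cliques *)

Lemma card_bigcup_le (I T : finType) (A : {pred I}) (F : I -> {set T}) n :
  {in A, forall i, #|F i| <= n} -> #|\bigcup_(i in A) F i| <= #|A| * n.
Proof.
move=> Fn; rewrite -sum_nat_const.
apply: (@leq_trans (\sum_(i in A) #|F i|)); last exact: leq_sum.
elim/big_ind2: _ => [|a A' b B leA leB|//]; first by rewrite cards0.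
by rewrite (leq_trans (leq_card_setU A' B)) // leq_add.
Qed.

Section CliqueCover.
Variables (G : sgraph) (K : finType) (kappa : G -> K).
Hypothesis clique : forall x y, kappa x = kappa y -> x != y -> adj x y.
Hypothesis claw_free : ~ contains_induced G claw.
Hypothesis bridge_free : ~ contains_induced G bridge.
Hypothesis C4twin_free : ~ contains_induced G C4twin.

Let claw_F := claw_freeE claw_free.
Let bridge_F := bridge_freeE bridge_free.
Let C4twin_F := C4twin_freeE C4twin_free.

Definition nbrs v i := [set x | (kappa x == i) && adj v x].
Definition conbrs v i := [set x | (kappa x == i) && ~~ adj v x].

Definition mixed v := [exists i, (2 < #|nbrs v i|) && (2 < #|conbrs v i|)].

(** Let adjacent v and w be mixed to the same clique, which they split into four
    parts.  Two common neighbours and two common nonneighbours give a bridge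
    whose central edge joins the former; two neighbours of v alone are the twins
    of a C4-twin with any neighbour of w alone.  So one part of each of these two
    pairs is nearly empty, too small for at least three neighbours and three
    nonneighbours on both sides. *)
Lemma card_mixed : #|[set v | mixed v]| <= #|{: K * K}|.
Proof.
rewrite -[leqRHS]muln1.
pose F (p : K * K) := [set v | [&& kappa v == p.1, 2 < #|nbrs v p.2| &
  2 < #|conbrs v p.2|]].
have sub : [set v | mixed v] \subset \bigcup_(p in {: K * K}) F p.
  apply/subsetP=> v; rewrite inE => /existsP[i vi].
  by apply/bigcupP; exists (kappa v, i) => //; rewrite inE eqxx.
apply: leq_trans (subset_leq_card sub) _; apply: card_bigcup_le => -[j i] _.
rewrite leqNgt; apply/card_gt1P => -[v [w []]]; rewrite !inE /=.
case/and3P=> /eqP vj nv cv /and3P[/eqP wj nw cw] vw.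
have avw : adj v w by apply: clique; rewrite ?vj ?wj.
have awv : adj w v by rewrite adj_sym.
pose A b c := [set x | [&& kappa x == i, adj v x == b & adj w x == c]].
have cl b c x : x \in A b c -> [/\ kappa x = i, adj v x = b & adj w x = c].
  by rewrite inE => /and3P[/eqP ? /eqP ? /eqP ?].
have both : #|A true true| <= 1 \/ #|A false false| <= 1.
  case: leqP => [|/card_gt1P[a [a' [/cl[ai va wa] /cl[ai' va' wa'] aa']]]].
    by left.
  case: leqP => [|/card_gt1P[b [b' [/cl[bi vb wb] /cl[bi' vb' wb'] bb']]]].
    by right.
  have adji x y : kappa x = i -> kappa y = i -> x != y -> adj x y.
    by move=> xi yi; apply: clique; rewrite xi.
  have ne x y : adj v x -> adj v y = false -> x != y.
    by move=> vx vy; apply: contraTneq vx => ->; rewrite vy.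
  case: (@bridge_F a a' v w b b');
    rewrite ?(adj_sym _ v) ?(adj_sym _ w) ?vb ?wb ?vb' ?wb' //;
    by apply: adji => //; apply: ne.
have diff : #|A true false| <= 1 \/ #|A false true| = 0.
  case: leqP => [|/card_gt1P[a [a' [/cl[ai va wa] /cl[ai' va' wa'] aa']]]].
    by left.
  right; apply/eqP; rewrite cards_eq0; apply/set0Pn => -[b /cl[bi vb wb]].
  have ne x : adj v x -> x != b.
    by move=> vx; apply: contraTneq vx => ->; rewrite vb.
  case: (@C4twin_F a a' v b w);
    rewrite ?(adj_sym _ v) ?(adj_sym b) ?vb ?wa ?wa' //;
    try by apply: clique; rewrite ?ai ?ai' ?bi // ?[b == _]eq_sym ?ne.
  apply: contraNneq aa' => vb'; have wi : kappa w = i by rewrite wj -vj vb'.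
  have weq x : kappa x = i -> adj w x = false -> x = w.
    by move=> xi wx; apply/eqP; apply: contraFT wx; rewrite eq_sym;
      apply: clique; rewrite xi.
  by rewrite (weq a) // (weq a').
have split_card (B X Y : {set G}) : B \subset X :|: Y -> #|B| <= #|X| + #|Y|.
  by move/subset_leq_card/leq_trans; apply; apply: leq_card_setU.
have nvE : #|nbrs v i| <= #|A true true| + #|A true false|.
  apply: split_card; apply/subsetP=> x; rewrite !inE.
  by case/andP=> -> ->; case: (adj w x).
have cvE : #|conbrs v i| <= #|A false true| + #|A false false|.
  apply: split_card; apply/subsetP=> x; rewrite !inE.
  by case/andP=> -> /negbTE->; case: (adj w x).
have nwE : #|nbrs w i| <= #|A true true| + #|A false true|.
  apply: split_card; apply/subsetP=> x; rewrite !inE.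
  by case/andP=> -> ->; case: (adj v x).
have cwE : #|conbrs w i| <= #|A true false| + #|A false false|.
  apply: split_card; apply/subsetP=> x; rewrite !inE.
  by case/andP=> -> /negbTE->; case: (adj v x).
lia.
Qed.

Definition dense v := [set i | 2 < #|nbrs v i|].

Definition type v : K * {set K} := (kappa v, dense v).

(** The predicted adjacency of two vertices with types [p] and [q]. *)
Definition linked (p q : K * {set K}) := q.1 \in p.2.

Definition dev v w := (v != w) && (adj v w != linked (type v) (type w)).

Let maxdev := #|K| * 2.

(** Large enough for a type class to escape the deviations of eight vertices. *)
Let big := 9 * maxdev.+1.

Let type_class (p : K * {set K}) := [set w | ~~ mixed w & type w == p].

Definition regular := [set v | ~~ mixed v & big <= #|type_class (type v)|].
Local Notation W := regular.

Lemma card_irregular :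
  #|~: W| <= #|{: K * K}| + #|{: K * {set K}}| * big.
Proof.
pose F p := if #|type_class p| < big then type_class p else set0.
have sub : ~: W \subset [set v | mixed v] :|:
    \bigcup_(p in {: K * {set K}}) F p.
  apply/subsetP=> v; rewrite !inE negb_and negbK -ltnNge.
  case: (boolP (mixed v)) => //= mv small; apply/bigcupP.
  by exists (type v); rewrite // /F small inE mv eqxx.
apply: leq_trans (subset_leq_card sub) _.
apply: leq_trans (leq_card_setU _ _) _; apply: leq_add card_mixed _.
apply: card_bigcup_le => p _; rewrite /F; case: ltnP => [/ltnW//|_].
by rewrite cards0.
Qed.

Lemma card_dev v : v \in W -> #|[set w | dev v w]| <= maxdev.
Proof.
rewrite inE => /andP[/existsPn mv _].
have sub : [set w | dev v w] \subset
    \bigcup_(i in {: K}) [set w | (kappa w == i) && dev v w].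
  apply/subsetP=> w; rewrite inE => vw; apply/bigcupP.
  by exists (kappa w) => //; rewrite inE eqxx.
apply: leq_trans (subset_leq_card sub) _; apply: card_bigcup_le => i _.
move: (mv i); rewrite negb_and -!leqNgt; case: (ltnP 2 #|nbrs v i|) => /= nv.
  apply: leq_trans; apply/subset_leq_card/subsetP => w.
  rewrite !inE /dev /linked /= => /andP[/eqP wi /andP[_]].
  by rewrite wi eqxx /dense inE nv; case: (adj v w).
move=> _; apply: (leq_trans _ nv); apply/subset_leq_card/subsetP => w.
rewrite !inE /dev /linked /= => /andP[/eqP wi /andP[_]].
by rewrite wi eqxx /dense inE ltnNge nv; case: (adj v w).
Qed.

Definition ball (X : {set G}) :=
  X :|: \bigcup_(x in X) [set w in W | dev x w].

Lemma card_ball (X : {set G}) : X \subset W -> #|ball X| <= #|X| * maxdev.+1.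
Proof.
move=> XW; rewrite mulnS (leq_trans (leq_card_setU _ _)) // leq_add2l.
apply: card_bigcup_le => x /(subsetP XW)/card_dev; apply: leq_trans.
by apply/subset_leq_card/subsetP=> w; rewrite !inE => /andP[].
Qed.

Lemma ball_sub (X : {set G}) : X \subset W -> ball X \subset W.
Proof.
move=> XW; rewrite subUset XW; apply/bigcupsP => x _; apply/subsetP => w.
by rewrite inE => /andP[].
Qed.

Lemma notin_ball (X : {set G}) x w : x \in X -> w \in W -> w \notin ball X ->
  x != w /\ adj x w = linked (type x) (type w).
Proof.
move=> xX wW; rewrite in_setU negb_or => /andP[wX /bigcupP nw].
have xw : x != w by apply: contraNneq wX => <-.
split=> //; apply/eqP/negPn/negP => dxw; apply: nw; exists x => //.
by rewrite inE wW /dev xw.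
Qed.

(** The supply of generic vertices from which the forbidden subgraphs below are
    assembled: the type of v has more vertices than deviate from those in xs. *)
Lemma far_exists v (xs : seq G) : v \in W -> all [in W] xs -> size xs <= 8 ->
  exists w, [/\ w \in W, type w = type v &
    {in xs, forall x, x != w /\ adj x w = linked (type x) (type v)}].
Proof.
move=> vW /allP xsW sz.
have XW : [set:: xs] \subset W by apply/subsetP => x; rewrite inE => /xsW.
have /subsetPn[w] : ~~ (type_class (type v) \subset ball [set:: xs]).
  apply: contraTN vW => /subset_leq_card le; rewrite inE negb_and -ltnNge.
  apply/orP; right; apply: (leq_ltn_trans le).
  apply: leq_ltn_trans (card_ball XW) _.
  by rewrite ltn_mul2r /= ltnS (leq_trans _ sz) // cardsE card_size.
rewrite inE => /andP[mw /eqP wv] nw.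
have wW : w \in W by move: vW; rewrite !inE mw wv => /andP[].
exists w; split=> // x xxs; rewrite -wv; apply: notin_ball nw => //.
by rewrite inE.
Qed.

Local Notation "v ~~~ w" := (linked (type v) (type w)) (at level 70).

Lemma linked_refl v : v \in W -> v ~~~ v.
Proof.
rewrite inE => /andP[_ vbig]; rewrite /linked /= inE.
have sub : type_class (type v) \subset v |: nbrs v (kappa v).
  apply/subsetP=> w; rewrite !inE => /andP[_ /eqP tw].
  have /= kw := congr1 fst tw; rewrite kw eqxx /=.
  by have [//|vw] := eqVneq w v; apply: clique; rewrite ?kw // eq_sym.
have := leq_trans vbig (subset_leq_card sub).
rewrite cardsU1 /big; case: (v \notin _) => /=; lia.
Qed.

(** A vertex of the type of y, generic with respect to three vertices of the type
    of x, sees all three and hence is almost complete to their clique. *)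
Lemma linked_sym v w : v \in W -> w \in W -> v ~~~ w = (w ~~~ v).
Proof.
suff imp x y : x \in W -> y \in W -> x ~~~ y -> y ~~~ x.
  by move=> vW wW; apply/idP/idP; apply: imp.
move=> xW yW xy.
have [||x2 [x2W tx2 fx2]] := far_exists (xs := [:: x]) xW => //.
  by rewrite /= xW.
have [||x3 [x3W tx3 fx3]] := far_exists (xs := [:: x; x2]) xW => //.
  by rewrite /= xW x2W.
have [||z [zW tz fz]] := far_exists (xs := [:: x; x2; x3]) yW => //.
  by rewrite /= xW x2W x3W.
rewrite -tz /linked /= inE; apply/card_gt2P; exists x, x2, x3.
have nz u : u \in [:: x; x2; x3] -> type u = type x -> u \in nbrs z (kappa x).
  move=> uxs tu; have [_ azu] := fz u uxs; have /= ku := congr1 fst tu.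
  by rewrite inE ku eqxx /= adj_sym azu tu.
split; split.
- by apply: nz; rewrite ?inE ?eqxx ?orbT.
- by apply: nz; rewrite ?inE ?eqxx ?orbT.
- by apply: nz; rewrite ?inE ?eqxx ?orbT.
- by case: (fx2 x); rewrite ?inE ?eqxx.
- by case: (fx3 x2); rewrite ?inE ?eqxx ?orbT.
- by case: (fx3 x); rewrite ?inE ?eqxx // eq_sym.
Qed.

(** If the type of y is almost complete to two almost anticomplete ones, then
    generic pairs of vertices of the three types form a bridge. *)
Lemma linked_trans x y z : x \in W -> y \in W -> z \in W ->
  x ~~~ y -> y ~~~ z -> x ~~~ z.
Proof.
move=> xW yW zW; rewrite linked_sym // => yx yz; apply/negPn/negP => xz.
have yy := linked_refl yW; have xx := linked_refl xW; have zz := linked_refl zW.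
have [||y2 [y2W ty2 fy2]] := far_exists (xs := [:: y]) yW => //.
  by rewrite /= yW.
have [||x1 [x1W tx1 fx1]] := far_exists (xs := [:: y; y2]) xW => //.
  by rewrite /= yW y2W.
have [||x2 [x2W tx2 fx2]] := far_exists (xs := [:: y; y2; x1]) xW => //.
  by rewrite /= yW y2W x1W.
have [||z1 [z1W tz1 fz1]] := far_exists (xs := [:: y; y2; x1; x2]) zW => //.
  by rewrite /= yW y2W x1W x2W.
have [||z2 [z2W tz2 fz2]] := far_exists (xs := [:: y; y2; x1; x2; z1]) zW => //.
  by rewrite /= yW y2W x1W x2W z1W.
apply: (@bridge_F y y2 x1 x2 z1 z2).
- by case: (fy2 y) => [|_ ->]; rewrite ?inE ?eqxx.
- by case: (fx1 y) => [|_ ->]; rewrite ?inE ?eqxx.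
- by case: (fx2 y) => [|_ ->]; rewrite ?inE ?eqxx.
- by case: (fx1 y2) => [|_ ->]; rewrite ?inE ?eqxx ?orbT ?ty2.
- by case: (fx2 y2) => [|_ ->]; rewrite ?inE ?eqxx ?orbT ?ty2.
- by case: (fx2 x1) => [|_ ->]; rewrite ?inE ?eqxx ?orbT ?tx1.
- by case: (fz1 y) => [|_ ->]; rewrite ?inE ?eqxx.
- by case: (fz2 y) => [|_ ->]; rewrite ?inE ?eqxx.
- by case: (fz1 y2) => [|_ ->]; rewrite ?inE ?eqxx ?orbT ?ty2.
- by case: (fz2 y2) => [|_ ->]; rewrite ?inE ?eqxx ?orbT ?ty2.
- by case: (fz2 z1) => [|_ ->]; rewrite ?inE ?eqxx ?orbT ?tz1.
- by case: (fz1 x1) => [|_ ->]; rewrite ?inE ?eqxx ?orbT ?tx1.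
- by case: (fz2 x1) => [|_ ->]; rewrite ?inE ?eqxx ?orbT ?tx1.
- by case: (fz1 x2) => [|_ ->]; rewrite ?inE ?eqxx ?orbT ?tx2.
- by case: (fz2 x2) => [|_ ->]; rewrite ?inE ?eqxx ?orbT ?tx2.
Qed.

Lemma linked_l x y z : x \in W -> y \in W -> z \in W -> x ~~~ y ->
  (x ~~~ z) = (y ~~~ z).
Proof.
move=> xW yW zW xy; apply/idP/idP; last exact: linked_trans.
by apply: linked_trans; rewrite // linked_sym.
Qed.

Lemma dev_sym : {in W &, symmetric dev}.
Proof. by move=> x y xW yW; rewrite /dev eq_sym adj_sym linked_sym. Qed.

Lemma dev_adj x y : dev x y -> adj x y = ~~ (x ~~~ y).
Proof. by case/andP=> _; case: (adj x y); case: (x ~~~ y). Qed.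

Lemma ndev_adj x y : x != y -> ~~ dev x y -> adj x y = (x ~~~ y).
Proof. by rewrite /dev => -> /negPn/eqP. Qed.

(** A deviating pair is a nonedge inside an almost-clique or an edge between two
    of them.  Suppose that z-w is far from x, b, c.  If x-b and b-c are nonedges,
    then {z, w}, nonadjacent and joined to all three, and the edge xc with b make
    a C4-twin.  If only one of them is a nonedge, there is a claw: at b with
    leaves c, z, w, or at w with leaves b, c, z.  If both are edges, then either
    x and c are in different almost-cliques and nonadjacent, which gives a claw
    at b with a third leaf in the almost-clique of b, or they are adjacent twins
    over b and z in a C4-twin closed by w. *)
Lemma dev_near x b c z w :
  x \in W -> b \in W -> c \in W -> z \in W -> w \in W ->
  dev x b -> dev b c -> x != c -> ~~ dev x c ->
  dev z w -> z ~~~ x -> w ~~~ b ->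
  (z \in ball [set x; b; c]) || (w \in ball [set x; b; c]).
Proof.
move=> xW bW cW zW wW dxb dbc nexc dxc dzw zx wb.
apply/negPn/negP; rewrite negb_or => /andP[zfar wfar].
have nebc : b != c by case/andP: dbc.
have axc := ndev_adj nexc dxc.
have axb := dev_adj dxb; have abc := dev_adj dbc; have azw := dev_adj dzw.
have abx : adj b x = ~~ (x ~~~ b) by rewrite adj_sym.
have [inx inb inc] : [/\ x \in [set x; b; c], b \in [set x; b; c]
    & c \in [set x; b; c]] by rewrite !inE !eqxx !orbT.
have [[nexz axz] [nexw axw]] := (notin_ball inx zW zfar, notin_ball inx wW wfar).
have [[nebz abz] [nebw abw]] := (notin_ball inb zW zfar, notin_ball inb wW wfar).
have [[necz acz] [necw acw]] := (notin_ball inc zW zfar, notin_ball inc wW wfar).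
have fz u : u \in W -> (z ~~~ u) = (x ~~~ u) by move=> uW; apply: linked_l.
have fw u : u \in W -> (w ~~~ u) = (b ~~~ u) by move=> uW; apply: linked_l.
rewrite linked_sym // fz // in axz; rewrite linked_sym // fz // in abz.
rewrite linked_sym // fz // in acz; rewrite linked_sym // fw // in axw.
rewrite linked_sym // fw // in abw; rewrite linked_sym // fw // in acw.
rewrite fz // (linked_sym xW wW) fw // (linked_sym bW xW) in azw.
have xx := linked_refl xW; have bb := linked_refl bW.
rewrite xx in axz; rewrite bb in abw.
have bx : (b ~~~ x) = (x ~~~ b) by exact: linked_sym.
rewrite bx in axw; move: axb abc abz axw acw azw axc acz.
have [xb|xb] := boolP (x ~~~ b); have [bc|bc] := boolP (b ~~~ c);
    move=> axb abc abz axw acw azw axc acz.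
- have xc : x ~~~ c by apply: linked_trans bc.
  rewrite xc in axc acz.
  apply: (@C4twin_F x c z w b); rewrite // ?axz ?acz ?abz ?azw ?abc //.
  + by rewrite adj_sym axb.
  + by case/andP: dzw.
- have xc : (x ~~~ c) = false by rewrite (linked_l xW bW cW xb); apply: negbTE.
  rewrite xc in axc acz.
  apply: (@claw_F b c z w); rewrite // ?acz ?acw ?azw ?abc ?abz ?abw //.
  by case/andP: dzw.
- have xc : (x ~~~ c) = false.
    by rewrite linked_sym // -(linked_l bW cW xW bc) bx; apply: negbTE.
  rewrite xc in axc acz.
  apply: (@claw_F w b c z); rewrite // ?abz ?acz ?abc //; rewrite adj_sym.
  + by rewrite abw.
  + by rewrite acw.
  + by rewrite azw.
have [xc|xc] := boolP (x ~~~ c); rewrite ?xc ?(negbTE xc) in axc acz.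
  apply: (@C4twin_F x c b z w); rewrite // ?axc ?axb ?axz ?acz ?abz //.
  - by rewrite adj_sym.
  - by rewrite adj_sym abw.
  - by rewrite adj_sym azw.
  - by rewrite adj_sym axw.
  - by rewrite adj_sym acw.
(* In the remaining case q is the third leaf of a claw at b. *)
have [||q [qW tq fq]] := far_exists (xs := [:: b; x; c]) bW => //.
  by rewrite /= bW xW cW.
have [] := fq b; first by rewrite mem_head.
have [] := fq x; first by rewrite !inE eqxx orbT.
have [] := fq c; first by rewrite !inE eqxx !orbT.
rewrite bb (negbTE xb) linked_sym // (negbTE bc) => necq acq nexq axq _ abq.
by apply: (@claw_F b x c q); rewrite // ?abx ?axc ?axq ?acq.
Qed.

Let maxexc := 3 * maxdev.+1 * maxdev.+1.

(** By [dev_near] a single nontransitive triple confines all deviating pairs of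
    its kind, and thus all nontransitive triples of this kind, to a bounded
    neighbourhood. *)
Lemma exceptional_exists (pq : (K * {set K}) * (K * {set K})) :
  exists B : {set G}, #|B| <= maxexc /\
    forall x b c, x \in W -> b \in W -> c \in W -> dev x b -> dev b c ->
      x != c -> ~~ dev x c -> type x = pq.1 -> type b = pq.2 -> x \in B.
Proof.
pose P (u : G * G * G) := [&& [&& u.1.1 \in W, u.1.2 \in W & u.2 \in W],
  dev u.1.1 u.1.2, dev u.1.2 u.2, u.1.1 != u.2 &
  [&& ~~ dev u.1.1 u.2, type u.1.1 == pq.1 & type u.1.2 == pq.2]].
have [/existsP[[[x b] c]]|/existsPn noP] := boolP [exists u, P u]; last first.
  exists set0; rewrite cards0; split=> // x b c xW bW cW xb bc xc dxc tx tb.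
  by case/negP: (noP (x, b, c)); rewrite /P /= xW bW cW xb bc xc dxc tx tb !eqxx.
case/and5P=> /= /and3P[xW bW cW] xb bc xc /and3P[dxc /eqP tx /eqP tb].
have XW : [set x; b; c] \subset W.
  by rewrite !subUset !sub1set xW bW cW.
exists (ball (ball [set x; b; c])); split.
  apply: leq_trans (card_ball (ball_sub XW)) _; rewrite leq_mul2r /=.
  apply: leq_trans (card_ball XW) _; rewrite leq_mul2r /=.
  by rewrite !cardsU !cards1; lia.
move=> y d e yW dW _ yd _ _ _ ty td.
have yx : y ~~~ x by rewrite ty -tx linked_refl.
have db : d ~~~ b by rewrite td -tb linked_refl.
case/orP: (dev_near xW bW cW yW dW xb bc xc dxc yd yx db) => [yB|dB].
  by rewrite inE yB.
rewrite in_setU; apply/orP; right; apply/bigcupP; exists d => //.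
by rewrite in_set yW dev_sym.
Qed.

(** The summands count the discarded vertices, the places in a class of deviating
    vertices, and the types.  Only the number of cliques enters. *)
Definition clique_cover_labels : finType :=
  (bool * option ('I_(#|{: K * K}| + #|{: K * {set K}}| * big +
                      #|{: (K * {set K}) * (K * {set K})}| * maxexc).+1 +
                  'I_(maxdev.+1) + (K * {set K})))%type.

Lemma clique_cover_cw_constructible : 0 < #|G| ->
  cw_constructible G #|{: clique_cover_labels}|.
Proof.
have [B BP] := fin_all_exists exceptional_exists.
pose S := ~: W :|: \bigcup_(pq in {: (K * {set K}) * (K * {set K})}) B pq.
have inS x : x \in ~: S -> x \in W /\ forall pq, x \notin B pq.
  rewrite in_setC in_setU negb_or in_setC negbK => /andP[-> xB]; split=> // pq.
  by apply: contra xB => xB; apply/bigcupP; exists pq.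
apply: (@blocks_cw_constructible _ _ _ _ S type linked dev).
- apply: leq_trans (leq_card_setU _ _) _; apply: leq_add card_irregular _.
  by apply: card_bigcup_le => pq _; case: (BP pq).
- by move=> x y /inS[xW _] /inS[yW _]; apply: dev_sym.
- move=> b x c /inS[bW _] /inS[xW xB] /inS[cW _] xb bc xc.
  apply/negPn/negP => dxc; case/negP: (xB (type x, type b)).
  by have [_ exc] := BP (type x, type b); apply: (exc x b c).
- move=> x /inS[xW _]; apply: leq_trans (card_dev xW).
  by apply/subset_leq_card/subsetP => y; rewrite !inE => /andP[].
by move=> x y _ _; apply: ndev_adj.
Qed.

End CliqueCover.

(** * Induced five-cycles *)

Section FiveCycle.
Variables (G : sgraph) (c : 'I_5 -> G).
Hypothesis c_inj : injective c.
Hypothesis c_adj : forall i j, adj (c i) (c j) = @adj C5 i j.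
Hypothesis claw_free : ~ contains_induced G claw.
Hypothesis fourK1_free : ~ contains_induced G fourK1.
Hypothesis C4twin_free : ~ contains_induced G C4twin.

Let trace v := [set i | adj v (c i)].

(** The order of [enum_rank] tells apart the two vertices of a nonadjacent pair
    complete to the cycle. *)
Let before v := [exists w, [&& trace w == setT, v != w, ~~ adj v w &
  enum_rank v < enum_rank w]].

(** The last component gives the vertices of the cycle colours of their own, so
    that elsewhere the vertices at hand are distinct from those of the cycle. *)
Definition five_cycle_colour v : {set 'I_5} * bool * option 'I_5 :=
  (trace v, before v, [pick i | c i == v]).

Lemma C5_boundary (A : {set 'I_5}) : A != set0 -> A != setT ->
  exists i j, [/\ i \in A, j \notin A & @adj C5 i j].
Proof.
move=> /set0Pn[i iA] AT.
have [/existsP[x /existsP[y /and3P[xA yA xy]]]|nobd] :=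
  boolP [exists x, exists y, [&& x \in A, y \notin A & @adj C5 x y]].
  by exists x, y.
case/eqP: AT; apply/setP => j; rewrite inE.
have step x : x \in A -> ordS x \in A.
  move=> xA; apply: contraNT nobd => yA; apply/existsP; exists x.
  apply/existsP; exists (ordS x); rewrite xA yA /=.
  by case: x {xA yA} => [[|[|[|[|[|//]]]]] ?].
have -> : j = iter (j + 5 - i) (@ordS 5) i.
  apply: val_inj; case: i {iA} => [[|[|[|[|[|//]]]]] ?];
  by case: j => [[|[|[|[|[|//]]]]] ?].
by elim: (j + 5 - i) => //= n; apply: step.
Qed.

Let c0 : 'I_5 := @Ordinal 5 0 isT.
Let c2 : 'I_5 := @Ordinal 5 2 isT.

(** Two nonneighbours of u would be the leaves, with u, of a claw at a vertex of
    the cycle, or the twins of a C4-twin over two nonadjacent cycle vertices. *)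
Lemma full_conbr u v w : trace u = setT -> trace v = setT -> trace w = setT ->
  u != v -> u != w -> ~~ adj u v -> ~~ adj u w -> v = w.
Proof.
have full x i : trace x = setT -> adj x (c i).
  by move/setP/(_ i); rewrite !inE.
move=> fu fv fw uv uw nuv nuw; apply/eqP/negPn/negP => vw.
have [avw|avw] := boolP (adj v w).
  apply: (C4twin_freeE C4twin_free (t := v) (t' := w) (p := c c0) (q := c c2)
    (r := u)) => //; try exact: full.
    by rewrite c_adj.
  by rewrite (inj_eq c_inj).
by apply: (claw_freeE claw_free (x := c c0) (a := u) (b := v) (c := w)) => //;
  rewrite adj_sym full.
Qed.

(** A neighbourhood in the cycle that is neither empty nor full has a boundary
    edge ij; with c i as centre and c j as third leaf, two nonadjacent vertices
    with this neighbourhood make a claw. *)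
Lemma five_cycle_colourP v w :
  five_cycle_colour v = five_cycle_colour w -> v != w -> adj v w.
Proof.
case=> Etr Ebef Epick vw; apply/negPn/negP => nvw.
have [nv nw] : (forall i, c i != v) /\ (forall i, c i != w).
  move: Epick vw; case: pickP => [i /eqP<-|nv].
    by case: pickP => // j /eqP <- [->]; rewrite eqxx.
  by case: pickP => // nw _; split=> i; rewrite ?nv ?nw.
have [tv0|tv0] := eqVneq (trace v) set0.
  have tw0 : trace w = set0 by rewrite -Etr.
  have nadj x i : trace x = set0 -> ~~ adj x (c i).
    by move/setP/(_ i); rewrite !inE => /negbT.
  apply: (fourK1_freeE fourK1_free (a := v) (b := w) (c := c c0) (d := c c2));
    rewrite ?(nadj v) ?(nadj w) //; first by rewrite c_adj.
  have [nv' nw'] : (forall i, v != c i) /\ (forall i, w != c i).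
    by split=> i; rewrite eq_sym.
  by rewrite /= !inE !negb_or vw !nv' !nw' (inj_eq c_inj).
have [tvT|tvT] := eqVneq (trace v) setT.
  have no x y : trace x = setT -> trace y = setT -> x != y -> ~~ adj x y ->
      before x = before y -> enum_rank x < enum_rank y -> False.
    move=> tx ty xy nxy bxy rxy.
    have : before x by apply/existsP; exists y; rewrite ty eqxx xy nxy rxy.
    rewrite bxy => /existsP[z /and4P[/eqP tz yz nyz ryz]].
    have E : x = z.
      by apply: (@full_conbr y) => //; rewrite 1?eq_sym 1?adj_sym.
    by move: (ltn_trans rxy ryz); rewrite E ltnn.
  have twT : trace w = setT by rewrite -Etr.
  have [lt|gt|/val_inj/enum_rank_inj E] := ltngtP (enum_rank v) (enum_rank w).
  - exact: no lt.
  - by apply: no gt; rewrite // 1?eq_sym 1?adj_sym.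
  - by rewrite E eqxx in vw.
have [i [j [iv jv ij]]] := C5_boundary tv0 tvT.
have [iw jw] : i \in trace w /\ j \notin trace w by rewrite -Etr.
rewrite !inE in iv jv iw jw.
apply: (claw_freeE claw_free (x := c i) (a := c j) (b := v) (c := w)) => //;
  by rewrite ?c_adj // adj_sym.
Qed.

End FiveCycle.

Theorem theorem7p17 :
  exists k : nat, forall G : sgraph,
    free [:: claw; fourK1; bridge; C4twin] G ->
    contains_induced G C5 ->
    cliquewidth G <= k.
Proof.
exists #|{: clique_cover_labels ({set 'I_5} * bool * option 'I_5)%type}|.
move=> G free [c c_inj c_adj].
have [nclaw n4K1 nbridge nC4twin] : [/\ ~ contains_induced G claw,
    ~ contains_induced G fourK1, ~ contains_induced G bridge
    & ~ contains_induced G C4twin].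
  by split; apply: free; rewrite /=; tauto.
have G_gt0 : 0 < #|G| by apply/card_gt0P; exists (c ord0).
apply: (cliquewidthP G_gt0).2.
apply: (clique_cover_cw_constructible (kappa := five_cycle_colour c)) => //.
exact: five_cycle_colourP.
Qed.
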